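(* Let $X$ be a real Banach space. If the closed dual unit ball $B_{X^*}$, endowed with the weak-star topology, is monolithic, then $X$ has the $c_0$-extension property with constant $2$.
   Context: A compact Hausdorff space $K$ is monolithic if every separable subspace of $K$ is second countable. For a real number $\lambda\ge 1$, a Banach space $X$ has the $c_0$-extension property with constant $\lambda$ if every bounded linear operator $T:Y\to c_0$ defined on a closed subspace $Y$ of $X$ admits a bounded linear extension $\tilde T:X\to c_0$ with $\|\tilde T\|\le\lambda\|T\|$. *)

(* Defs.v *)
From HB Require Import structures.
From mathcomp Require Import all_boot all_order all_algebra.
From mathcomp Require Import all_classical all_reals all_analysis.

Set Implicit Arguments.
Unset Strict Implicit.
Unset Printing Implicit Defensive.

Import Order.TTheory GRing.Theory Num.Theory.
Import numFieldNormedType.Exports.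

Local Open Scope classical_set_scope.
Local Open Scope ring_scope.

Definition separable (T : topologicalType) : Prop :=
  exists2 D : set T, countable D & dense D.

(* Subspaces carry the topology of [set_type], i.e. the initial topology of the
   inclusion.  The notion is meant for compact Hausdorff [K]; the dual ball
   below is always such a space, by the Banach-Alaoglu theorem. *)
Definition monolithic (K : topologicalType) : Prop :=
  forall A : set K, separable A -> second_countable (T := A).

Section Operators.
Context {R : realType} {V W : normedModType R}.

Definition bounded_operator (f : V -> W) : Prop :=
  exists M : R, forall x, `|f x| <= M * `|x|.

(* [sup] is 0 on unbounded sets, so this is only meaningful for bounded [f]. *)
Definition opnorm (f : V -> W) : R :=
  sup [set `|f x| | x in [set x : V | `|x| <= 1]].

End Operators.

Section WeakStar.
Context {R : realType} (X : normedModType R).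

Record dual : Type := Dual {
  dual_fun :> {linear X -> R^o} ;
  dual_continuous : continuous dual_fun }.

HB.instance Definition _ := gen_eqMixin dual.
HB.instance Definition _ := gen_choiceMixin dual.

(* The coarsest topology on the dual making all evaluations continuous. *)
Definition weak_star : Type :=
  sup_topology (fun x : X =>
    Topological.class (initial_topology (fun f : dual => f x : R^o))).

HB.instance Definition _ := Topological.on weak_star.

Definition dual_ball : set weak_star := [set f : dual | opnorm f <= 1].

End WeakStar.

Arguments dual_ball {R} X.

Section Subspace.
Context {R : realType} {X : normedModType R}.

Definition subsp (Y : submodClosed X) : Type := {x : X | x \in Y}.

Context (Y : submodClosed X).

HB.instance Definition _ := SubChoice.on (subsp Y).
HB.instance Definition _ := [SubChoice_isSubLmodule of subsp Y by <:].

Let subsp_norm (y : subsp Y) : R := `|val y|.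

Fact subsp_ler_normD x y : subsp_norm (x + y) <= subsp_norm x + subsp_norm y.
Proof. exact: ler_normD. Qed.

Fact subsp_normrZ (l : R) x : subsp_norm (l *: x) = `|l| * subsp_norm x.
Proof. exact: normrZ. Qed.

Fact subsp_normr0_eq0 x : subsp_norm x = 0 -> x = 0.
Proof. by move=> /normr0_eq0 x0; apply: val_inj. Qed.

HB.instance Definition _ := Lmodule_isNormed.Build R (subsp Y)
  subsp_ler_normD subsp_normrZ subsp_normr0_eq0.

End Subspace.

Section C0.
Context (R : realType).

Definition null_sequence : {pred nat -> R^o} :=
  [pred u : nat -> R^o | `[< u @ \oo --> (0 : R^o) >]].

Fact null_sequence_submod_closed : submod_closed null_sequence.
Proof.
split=> [|a u v]; first by apply/asboolP; exact: cvg_cst.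
move=> /asboolP u0 /asboolP v0; apply/asboolP.
rewrite -[X in _ --> X](addr0 (0 : R^o)) -[X in _ --> X + _](scaler0 _ a).
by apply: cvgD => //; exact: cvgZr.
Qed.

HB.instance Definition _ :=
  GRing.isSubmodClosed.Build R (nat -> R^o) null_sequence
    null_sequence_submod_closed.

Definition c0 : Type := {u : nat -> R^o | u \in null_sequence}.

HB.instance Definition _ := SubChoice.on c0.
HB.instance Definition _ := [SubChoice_isSubLmodule of c0 by <:].

Definition c0_norm (u : c0) : R := sup (range (fun n => `|val u n|)).

Fact c0_has_sup (u : c0) : has_sup (range (fun n => `|val u n|)).
Proof.
split; first by exists `|val u 0|, 0%N.
have /asboolP u0 := valP u.
have /pinfty_ex_gt0[M _ uM] := cvg_seq_bounded (cvgP _ u0).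
by exists M => _ [n _ <-]; exact: uM.
Qed.

Fact c0_le_norm (u : c0) n : `|val u n| <= c0_norm u.
Proof. by apply: (sup_upper_bound (c0_has_sup u)); exists n. Qed.

Fact c0_norm_le (u : c0) M : (forall n, `|val u n| <= M) -> c0_norm u <= M.
Proof.
by move=> uM; apply: ge_sup => [|_ [n _ <-]//]; case: (c0_has_sup u).
Qed.

Fact c0_ler_normD u v : c0_norm (u + v) <= c0_norm u + c0_norm v.
Proof.
apply: c0_norm_le => n; apply: le_trans (ler_normD _ _) _.
by rewrite lerD// c0_le_norm.
Qed.

Fact c0_normrZ (l : R) u : c0_norm (l *: u) = `|l| * c0_norm u.
Proof.
have le (a : R) w : c0_norm (a *: w) <= `|a| * c0_norm w.
  apply: c0_norm_le => n; rewrite [leLHS](normrZ a (val w n)).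
  by rewrite ler_wpM2l// c0_le_norm.
apply/eqP; rewrite eq_le le/=.
have [->|l0] := eqVneq l 0.
  by rewrite normr0 mul0r (le_trans _ (c0_le_norm _ 0)).
rewrite -ler_pdivlMl ?normr_gt0// -normfV.
by apply: le_trans (le _ _); rewrite scalerA mulVf// scale1r.
Qed.

Fact c0_normr0_eq0 u : c0_norm u = 0 -> u = 0.
Proof.
move=> u0; apply/val_inj/funext => n; apply/normr0_eq0/eqP.
by rewrite eq_le normr_ge0 andbT -u0 c0_le_norm.
Qed.

HB.instance Definition _ := Lmodule_isNormed.Build R c0
  c0_ler_normD c0_normrZ c0_normr0_eq0.

End C0.

Definition c0_extension_property (R : realType) (lambda : R)
    (X : normedModType R) : Prop :=
  forall Y : submodClosed X, closed [set x : X | x \in Y] ->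
  forall T : {linear subsp Y -> c0 R}, bounded_operator T ->
  exists Tt : {linear X -> c0 R},
    [/\ bounded_operator Tt,
        forall y : subsp Y, Tt (val y) = T y
      & opnorm Tt <= lambda * opnorm T].

(* Main.v *)
(* Extend the normalised coordinate functionals of T to h_n in the dual ball by
   Hahn-Banach.  The weak-star closure L of {h_n} is separable, hence second
   countable, so some sequence d_k in X separates the points of L.  Every limit
   of (h_n) along a free ultrafilter lies in L and vanishes on Y, so for each k
   all but finitely many h_n are close on d_0, ..., d_(k-1) to a point of L
   vanishing on Y.  A diagonal choice yields z_n in L vanishing on Y with
   h_n - z_n -> 0 at every d_k, hence, by comparing ultrafilter limits in L, at
   every point of X.  The differences h_n - z_n, of norm at most 2, are the
   coordinates of the extension, up to the factor |T|. *)
Require Import Defs.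
From HB Require Import structures.
From mathcomp Require Import all_boot all_order all_algebra.
From mathcomp Require Import all_classical all_reals all_analysis.
From mathcomp Require Import ring.

Set Implicit Arguments.
Unset Strict Implicit.
Unset Printing Implicit Defensive.

Import Order.TTheory GRing.Theory Num.Theory.
Import numFieldNormedType.Exports.

Local Open Scope classical_set_scope.
Local Open Scope ring_scope.

(** Bundles a map whose linearity is established only after its construction, as for maps produced
    by [choice]. *)
Lemma linear_funP (R : pzRingType) (U V : lmodType R) (f : U -> V) :
  linear f -> exists g : {linear U -> V}, g =1 f.
Proof.
move=> lf; pose m := GRing.isLinear.Build R U V *:%R f lf.
by exists (HB.pack_for {linear U -> V} f m).
Qed.

(** * Hahn-Banach extension of functionals dominated by the norm *)

Section HahnBanach.
Context {R : realType} {V : normedModType R}.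
Implicit Types (G : set (V * R^o)) (x : V) (r : R).

(** Partial functionals as subspaces of [V * R^o]: extension becomes inclusion, chains have unions,
    and single-valuedness follows from domination. *)
Definition dominated_graph G :=
  [/\ G (0, 0),
      (forall a u v, G u -> G v -> G (a *: u + v))
    & forall x r, G (x, r) -> r <= `|x|].

(** The difference of the two points is [(0, s - r)], so domination at 0 gives [s <= r]; the roles
    are symmetric. *)
Lemma dominated_graph_functional G x r s :
  dominated_graph G -> G (x, r) -> G (x, s) -> r = s.
Proof.
move=> [_ Glin Gdom] Gr Gs.
have le r1 r2 : G (x, r1) -> G (x, r2) -> r2 <= r1.
  move=> G1 G2; have /Gdom := Glin (-1) _ _ G1 G2.
  by rewrite scaleN1r /= addNr normr0 addrC subr_le0.
by apply/eqP; rewrite eq_le !le.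
Qed.

(* The slope at x0 is the supremum of r - |x - x0| over the graph, the least
   value compatible with domination on the side x - t x0. *)
Lemma dominated_graph_extend G x0 : dominated_graph G ->
  exists2 G', dominated_graph G' & G `<=` G' /\ exists r, G' (x0, r).
Proof.
move=> [G0 Glin Gdom].
have key x r y s : G (x, r) -> G (y, s) -> r - `|x - x0| <= `|y + x0| - s.
  move=> Gr Gs; have /Gdom := Glin 1 _ _ Gr Gs.
  rewrite !scale1r /= => rs; rewrite lerBlDr addrAC lerBrDr.
  apply: le_trans rs _; rewrite (_ : x + y = (y + x0) + (x - x0)) ?ler_normD//.
  by rewrite addrACA [x0 - x0]subrr addr0 addrC.
pose A := [set p.2 - `|p.1 - x0| | p in G].
have supA : has_sup A.
  split; first by exists (0 - `|0 - x0|), (0, 0).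
  exists `|0 + x0|; move=> _ [[x r] /= Gr <-].
  by have := key _ _ _ _ Gr G0; rewrite subr0.
pose a : R^o := sup A.
have upA x r : G (x, r) -> r <= a + `|x - x0|.
  by move=> Gr; rewrite -lerBlDr; apply: sup_upper_bound => //; exists (x, r).
have lowA y s : G (y, s) -> s + a <= `|y + x0|.
  move=> Gs; rewrite addrC -lerBrDr; apply: ge_sup; first by case: supA.
  by move=> _ [[x r] /= Gr <-]; exact: key.
exists [set u | exists t p, G p /\ u = p + t *: (x0, a)].
  split.
  - by exists 0, (0, 0); split=> //; rewrite scale0r addr0.
  - move=> b _ _ [t [p [Gp ->]]] [t' [p' [Gp' ->]]].
    exists (b * t + t'), (b *: p + p'); split; first exact: Glin.
    by rewrite scalerDr scalerDl scalerA addrACA.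
  - move=> _ _ [t [[x r] [Gp [-> ->]]]] /=.
    have GZ b : G (b *: x, b * r).
      by have := Glin b _ _ Gp G0; rewrite addr0.
    change (r + t * a <= `|x + t *: x0|).
    (* By homogeneity, [t > 0] reduces to [lowA] at [t^-1 *: x] and [t < 0] to [upA] at
       [(- t)^-1 *: x]. *)
    have [t0|t0|->] := ltgtP t 0; last first.
    + by rewrite mul0r scale0r !addr0; exact: Gdom.
    + have := lowA _ _ (GZ t^-1).
      rewrite -(ler_pM2l t0) mulrDr mulVKf ?gt_eqF// => /le_trans; apply.
      rewrite -{1}(gtr0_norm t0) -normrZ scalerDr scalerA divff ?gt_eqF//.
      by rewrite scale1r.
    + have u0 : 0 < - t by rewrite oppr_gt0.
      have := upA _ _ (GZ (- t)^-1).
      rewrite -(ler_pM2l u0) mulVKf ?gt_eqF// mulrDr -lerBlDl mulNr opprK.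
      move=> /le_trans; apply.
      rewrite -{1}(gtr0_norm u0) -normrZ scalerBr scalerA divff ?gt_eqF//.
      by rewrite scale1r scaleNr opprK.
split; first by move=> p Gp; exists 0, p; rewrite scale0r addr0.
by exists a, 1, (0, 0); rewrite scale1r add0r.
Qed.

Lemma dominated_graph_total G : dominated_graph G ->
  exists2 H, dominated_graph H & G `<=` H /\ forall x, exists r, H (x, r).
Proof.
move=> dG.
(* The union with [G] is there for the empty chain, whose union is [set0]. *)
pose P H := dominated_graph (G `|` H).
have [F FP Ftot|H [PH maxH]] := @Zorn_bigcup _ P.
  (* As the chain is totally ordered, any two points of the union already lie in one dominated
     graph. *)
  have pair p q : (G `|` \bigcup_(X in F) X) p ->
      (G `|` \bigcup_(X in F) X) q ->
      exists2 X, P X & [/\ (G `|` X) p, (G `|` X) q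
        & X `<=` \bigcup_(X in F) X].
    have P0 : P set0 by rewrite /P setU0.
    move=> [Gp|[X FX Xp]] [Gq|[Z FZ Zq]].
    - by exists set0 => //; split; [left|left|exact: sub0set].
    - exists Z; first exact: FP.
      by split; [left|right|exact: bigcup_sup].
    - exists X; first exact: FP.
      by split; [right|left|exact: bigcup_sup].
    - have [XZ|ZX] := Ftot _ _ FX FZ.
      + exists Z; first exact: FP.
        by split; [right; exact: XZ|right|exact: bigcup_sup].
      + exists X; first exact: FP.
        by split; [right|right; exact: ZX|exact: bigcup_sup].
  split; first by left; case: dG.
  - move=> a u v Gu Gv; have [X [_ Xlin _] [Xu Xv XF]] := pair _ _ Gu Gv.
    by have [|/XF] := Xlin a u v Xu Xv; [left|right].
  - move=> x r Gx; have [X [_ _ Xdom] [Xx _ _]] := pair _ _ Gx Gx.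
    exact: Xdom Xx.
exists (G `|` H) => //; split=> // x.
have [H' dH' [HH' [r H'x]]] := dominated_graph_extend x PH.
exists r; apply: contrapT => nHx; apply: (maxH H').
  split; first by move=> p Hp; apply: HH'; right.
  by move=> /(_ _ H'x) Hx; apply: nHx; right.
rewrite /P (_ : G `|` H' = H')//; apply/setUidPr => p Gp; apply: HH'; left.
exact: Gp.
Qed.

Theorem hahn_banach (Y : submodClosed V) (f : {linear subsp Y -> R^o}) :
  (forall y, `|f y| <= `|val y|) ->
  exists2 g : {linear V -> R^o},
    forall y, g (val y) = f y & forall x, `|g x| <= `|x|.
Proof.
move=> fle; pose G := [set p : V * R^o | exists y, p = (val y, f y)].
have dG : dominated_graph G.
  split; first by exists 0; rewrite !linear0.
  - by move=> a _ _ [u ->] [v ->]; exists (a *: u + v); rewrite !linearP.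
  - by move=> _ _ [y [-> ->]]; apply: le_trans (ler_norm _) (fle y).
have [H dH [GH /choice[h Hh]]] := dominated_graph_total dG.
have hE x r : H (x, r) -> r = h x.
  by move=> Hr; exact: dominated_graph_functional dH Hr (Hh x).
have [_ Hlin Hdom] := dH.
have [a u v|g gE] := @linear_funP R V R^o h.
  by apply/esym/hE; exact: Hlin (Hh u) (Hh v).
exists g => [y|x]; first by rewrite gE; apply/esym/hE/GH; exists y.
(* Domination bounds [g] only from above; the lower bound is the upper one at [- x]. *)
rewrite ler_norml lerNl -linearN; apply/andP; split.
  by rewrite -normrN gE; exact: Hdom.
by rewrite gE; exact: Hdom.
Qed.

End HahnBanach.

(** * Operator norm of bounded linear maps *)

Section OperatorNorm.
Context {R : realType} {V W : normedModType R}.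
Implicit Type f : {linear V -> W}.

Lemma opnorm_has_sup f : bounded_operator f ->
  has_sup [set `|f x| | x in [set x : V | `|x| <= 1]].
Proof.
move=> [M fM]; split; first by exists `|f 0|, 0 => //=; rewrite normr0.
exists `|M| => _ [x /= x1 <-]; apply: le_trans (fM x) _.
by apply: (le_trans (ler_norm _)); rewrite normrM normr_id ler_piMr.
Qed.

Lemma opnorm_ge0 f : bounded_operator f -> 0 <= opnorm f.
Proof.
move=> /opnorm_has_sup supf; apply: (@le_trans _ _ `|f 0|) => //.
by apply: sup_upper_bound => //; exists 0 => //=; rewrite normr0.
Qed.

Lemma le_opnorm f x : bounded_operator f -> `|f x| <= opnorm f * `|x|.
Proof.
move=> /opnorm_has_sup supf.
have [->|x0] := eqVneq x 0; first by rewrite linear0 !normr0 mulr0.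
rewrite -ler_pdivrMr ?normr_gt0//; apply: sup_upper_bound => //.
exists (`|x|^-1 *: x) => /=.
  by rewrite normrZ normfV normr_id mulVf// normr_eq0.
by rewrite linearZ normrZ normfV normr_id mulrC.
Qed.

Lemma opnorm_le f M : 0 <= M -> (forall x, `|f x| <= M * `|x|) -> opnorm f <= M.
Proof.
move=> M0 fM; apply: ge_sup.
  by exists `|f 0|, 0 => //=; rewrite normr0.
move=> _ [x /= x1 <-]; apply: le_trans (fM x) _.
by rewrite ler_piMr.
Qed.

Lemma continuous_bounded_operator f : bounded_operator f <-> continuous f.
Proof.
rewrite -linear_bounded_continuous linear_boundedP; split.
  move=> [M fM]; near=> r => x; apply: le_trans (fM x) _.
  by rewrite ler_wpM2r//; near: r; exact: nbhs_pinfty_ge.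
by move=> /pinfty_ex_gt0[M _ fM]; exists M.
Unshelve. all: by end_near. Qed.

End OperatorNorm.

(** * Membership and limits tested on finer ultrafilters *)

Section Ultrafilters.
Context {T : Type} {F : set_system T} {FF : ProperFilter F}.

(** The trace of [F] on the complement of [P] is proper because [P] is not in [F]; any ultrafilter
    above it works. *)
Lemma not_near_ultra (P : set T) : ~ F P ->
  exists U : set_system T, [/\ UltraFilter U, F `<=` U & U (~` P)].
Proof.
move=> FP; pose G := within (~` P) F.
have GG : ProperFilter G.
  apply: Build_ProperFilter_ex.
  move=> A GA; apply: contrapT => A0; apply: FP; near=> t.
  apply: contrapT => Pt; apply: A0; exists t.
  by move: Pt; near: t.
have [U [UU GU]] := ultraFilterLemma GG.
exists U; split=> //; last by apply: GU; exact: withinT.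
by move=> A FA; apply: GU; rewrite /G /within /=; apply: filterS FA.
Unshelve. all: by end_near. Qed.

Lemma ultra_cvg (K : topologicalType) (u : T -> K) (l : K) :
  (forall U, UltraFilter U -> F `<=` U -> u t @[t --> U] --> l) ->
  u t @[t --> F] --> l.
Proof.
move=> ucvg A Al; apply: contrapT => /not_near_ultra[U [UU FU UA]].
have UuA : U (u @^-1` A) by exact: ucvg Al.
by have [t []] := @filter_ex _ _ _ _ (filterI UA UuA).
Qed.

End Ultrafilters.

Lemma fmap_ultra (S T : Type) (f : S -> T) (U : set_system S) :
  UltraFilter U -> UltraFilter (f t @[t --> U]).
Proof.
move=> UU; apply: Build_UltraFilter => G GG UG.
apply/seteqP; split=> // A GA.
have [//|UnA] := in_ultra_setVsetC (f @^-1` A) UU.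
have GnA : G (~` A) by exact: UG.
by have [x []] := @filter_ex _ _ _ _ (filterI GA GnA).
Qed.

Lemma ultra_bounded_cvg (R : realType) T (U : set_system T)
    (u : T -> R^o) (M : R) :
  UltraFilter U -> (forall t, `|u t| <= M) -> cvg (u t @[t --> U]).
Proof.
move=> UU uM; have := @segment_compact R (- M) M; rewrite compact_ultra.
move=> /(_ _ (fmap_ultra u UU))[|l [_ ul]]; last by apply/cvg_ex; exists l.
by apply: (@filterE T U) => t; rewrite /= in_itv /= -ler_norml; exact: uM.
Qed.

Lemma separable_closure (T : topologicalType) (D : set T) :
  countable D -> separable (closure D).
Proof.
move=> /countable_injP[f finj].
exists (set_val @^-1` D).
  apply/countable_injP; exists (f \o set_val) => x y xD yD /= fxy.
  by apply/val_inj/finj.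
move=> O [a Oa] [B Bop BO]; rewrite -BO in Oa *.
have [d [Dd Bd]] : D `&` B !=set0.
  exact: set_mem (valP a) _ (open_nbhs_nbhs (conj Bop Oa)).
by exists (SigSub (mem_set (subset_closure Dd))).
Qed.

(** * Weak-star topology and compactness of the dual ball *)

Section WeakStarTopology.
Context {R : realType} {X : normedModType R}.

Lemma weak_star_cvgP (F : set_system (weak_star X)) (p : weak_star X) :
  Filter F ->
  (F --> p <-> forall x, (f : dual X) x @[f --> F] --> (p : dual X) x).
Proof.
move=> FF; rewrite cvg_sup; split=> Fp x.
  apply: cvg_trans (@initial_continuous _ _ (fun f : dual X => f x : R^o) p).
  exact: cvg_app (Fp x).
move=> A /= [_ [[B Bop <-] Bp] BA].
by apply: filterS BA _; apply: Fp; exact: open_nbhs_nbhs.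
Qed.

Lemma dual_ballP (f : dual X) :
  dual_ball X f <-> forall x, `|f x| <= `|x|.
Proof.
have fb := (continuous_bounded_operator f).2 (@dual_continuous _ _ f).
split=> [f1 x|f1].
  by apply: (le_trans (le_opnorm x fb)); rewrite ler_piMl.
by apply: opnorm_le => // x; rewrite mul1r.
Qed.

Lemma dual_exists (f : {linear X -> R^o}) :
  (forall x, `|f x| <= `|x|) ->
  exists p : dual_ball X, forall x, (val p : dual X) x = f x.
Proof.
move=> f1; have fc : continuous f.
  by apply/continuous_bounded_operator; exists 1 => x; rewrite mul1r.
have fB : dual_ball X (Dual fc) by apply/dual_ballP.
by exists (SigSub (mem_set fB)).
Qed.

Definition evaluation (x : X) (p : dual_ball X) : R^o := (val p : dual X) x.

Lemma evaluation_le x p : `|evaluation x p| <= `|x|.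
Proof. by have /dual_ballP := set_mem (valP p); exact. Qed.

Lemma dual_ball_cvgP (F : set_system (dual_ball X)) (p : dual_ball X) :
  Filter F ->
  (F --> p <-> forall x, evaluation x f @[f --> F] --> evaluation x p).
Proof.
move=> FF; split=> [Fp|Fp].
  apply/(weak_star_cvgP (set_val p) (fmap_filter set_val FF)).
  by apply: cvg_trans (@initial_continuous _ _ set_val p); exact: cvg_app.
move=> A /= [_ [[B Bop <-] Bp] BA].
apply: filterS BA _.
apply: (weak_star_cvgP (set_val p) (fmap_filter set_val FF)).2 => //.
exact: open_nbhs_nbhs.
Qed.

Lemma evaluation_continuous x : continuous (evaluation x).
Proof. by move=> p; exact: ((dual_ball_cvgP p (nbhs_filter p)).1 _ x). Qed.

(** Banach-Alaoglu in ultrafilter form: the bounded scalar values converge pointwise, and linearity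
    and the norm bound pass to the limit. *)
Lemma dual_ball_ultra_cvg T (U : set_system T) (u : T -> dual_ball X) :
  UltraFilter U -> exists p : dual_ball X, u t @[t --> U] --> p.
Proof.
move=> UU.
have /choice[h uh] x : exists l : R^o, evaluation x (u t) @[t --> U] --> l.
  have := @ultra_bounded_cvg R T U (fun t => evaluation x (u t)) `|x| UU.
  by move=> /(_ (fun t => evaluation_le x (u t)))/cvg_ex.
have [a x y|f fh] := @linear_funP R X R^o h.
  have lin : evaluation (a *: x + y) \o u =
      (fun t => a *: evaluation x (u t) + evaluation y (u t)).
    by apply/funext => t; rewrite /evaluation /= linearP.
  have := uh (a *: x + y); rewrite -[X in X @ _]/(_ \o u) lin => h1.
  apply: (cvg_unique (@norm_hausdorff R R^o) h1).
  by apply: cvgD; [exact: cvgZl_tmp|]; exact: uh.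
have [x|p pf] := @dual_exists f.
  rewrite fh.
  apply: (closed_cvg (fun l : R^o => `|l| <= `|x|) _ _ _ (uh x)).
    apply: preimage_closed (@closed_le R `|x|) => l _.
    exact: norm_continuous.
  by apply: nearW => t; exact: evaluation_le.
exists p; apply/dual_ball_cvgP => x.
by rewrite /evaluation pf fh; exact: uh.
Qed.

Lemma evaluation_cvg T (F : set_system T) {FF : Filter F}
    (u : T -> dual_ball X) p x :
  u t @[t --> F] --> p -> evaluation x (u t) @[t --> F] --> evaluation x p.
Proof. by move=> up; apply: cvg_comp up _; exact: evaluation_continuous. Qed.

End WeakStarTopology.

(** * Countable separation and diagonal choice *)

(** For each of the countably many pairs of basic open sets, pick a vector whose evaluation takes no
    common value on the two, if one exists. Points that differ at [x] have basic neighbourhoods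
    forming such a pair. *)
Lemma separating_sequence (R : realType) (X : normedModType R)
    (A : set (dual_ball X)) : second_countable (T := A) ->
  exists d : nat -> X, forall p q, A p -> A q ->
    (forall k, evaluation (d k) p = evaluation (d k) q) ->
    forall x, evaluation x p = evaluation x q.
Proof.
move=> [B /countable_injP[e einj] [_ Bbasis]].
pose sep (mn : nat * nat) x := exists U V : set A,
  [/\ B U, B V, e U = mn.1 /\ e V = mn.2
    & forall p q, U p -> V q -> evaluation x (val p) <> evaluation x (val q)].
pose d k := if unpickle k is Some mn then xget 0 (sep mn) else 0.
exists d => p q Ap Aq dpq x; apply: contrapT => /eqP pq.
(* With half the gap as radius, values near [p] and values near [q] cannot coincide. *)
pose r := `|evaluation x p - evaluation x q| / 2.
have r0 : 0 < r by rewrite divr_gt0// normr_gt0 subr_eq0.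
have nearby (s : A) : exists U, [/\ B U, U s
    & forall t, U t -> `|evaluation x (val s) - evaluation x (val t)| < r].
  have sr : nbhs s [set t | `|evaluation x (val s) - evaluation x (val t)| < r].
    have : (evaluation x \o val) t @[t --> s] --> evaluation x (val s).
      apply: continuous_comp; first exact: initial_continuous.
      exact: evaluation_continuous.
    by move=> /cvgrPdist_lt; exact.
  by have [U [BU Us] Usub] := Bbasis s _ sr; exists U.
have [U [BU Up Ur]] := nearby (SigSub (mem_set Ap)).
have [V [BV Vq Vr]] := nearby (SigSub (mem_set Aq)).
have sepx : sep (e U, e V) x.
  exists U, V; split=> // s t /Ur/= ps /Vr/= qt st.
  have := ltrD ps qt; rewrite -splitr ltNge => /negP; apply.
  by rewrite (distrC (evaluation x q)) st; exact: ler_distD.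
(* The vector stored at this code comes with its own pair of sets; injectivity of [e] identifies it
   with [U] and [V]. *)
have [U' [V' [BU' BV' [eU eV]]]] :=
  xgetPex 0 (ex_intro (sep (e U, e V)) x sepx).
have -> : U' = U by apply: einj; rewrite ?inE.
have -> : V' = V by apply: einj; rewrite ?inE.
move=> /(_ _ _ Up Vq)/=; have := dpq (pickle (e U, e V)).
by rewrite /d pickleK.
Qed.

(** Let [z n] meet every solvable condition [E k n] with [k <= n]: as the conditions are nested, a
    witness for the last solvable one meets them all. *)
Lemma diagonal_choice (T : Type) (E : nat -> nat -> T -> Prop) :
  (forall k n z, E k.+1 n z -> E k n z) ->
  (forall n, exists z, E 0 n z) ->
  (forall k, \forall n \near \oo, exists z, E k n z) ->
  exists z : nat -> T, (forall n, E 0 n (z n)) /\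
    forall k, \forall n \near \oo, E k n (z n).
Proof.
move=> Edecr E0 Enear.
have Ele k l n z : (k <= l)%N -> E l n z -> E k n z.
  elim: l => [|l IHl]; first by rewrite leqn0 => /eqP ->.
  by rewrite leq_eqVlt => /predU1P[-> //|/IHl{}IHl /Edecr].
have best n m :
    exists z, forall k, (k <= m)%N -> (exists t, E k n t) -> E k n z.
  elim: m => [|m [z zm]].
    by have [z Ez] := E0 n; exists z => k; rewrite leqn0 => /eqP ->.
  have [[t Et]|nE] := pselect (exists t, E m.+1 n t).
    by exists t => k km _; exact: Ele km Et.
  exists z => k; rewrite leq_eqVlt => /predU1P[-> //|]; exact: zm.
have /choice[z zP] n := best n n.
exists z; split=> [n|k]; first exact: zP.
near=> n; apply: zP; last by near: n; exact: Enear.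
by near: n; exact: nbhs_infty_ge.
Unshelve. all: by end_near. Qed.

(** * Weak-star approximation by functionals vanishing on a set *)

Theorem weak_star_null_approximation (R : realType) (X : normedModType R)
    (Y : set X) (h : nat -> dual_ball X) :
  monolithic (dual_ball X) ->
  (forall y, Y y -> evaluation y (h n) @[n --> \oo] --> 0) ->
  exists z : nat -> dual_ball X,
    (forall n y, Y y -> evaluation y (z n) = 0) /\
    forall x, evaluation x (h n) - evaluation x (z n) @[n --> \oo] -->
      (0 : R^o).
Proof.
move=> mono hY; pose L := closure (range h).
have [d dsep] : exists d : nat -> X, forall p q, L p -> L q ->
    (forall k, evaluation (d k) p = evaluation (d k) q) ->
    forall x, evaluation x p = evaluation x q.
  apply: separating_sequence; apply: mono; apply: separable_closure.
  exact: card_image_le.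
have Lh n : L (h n) by apply: subset_closure; exists n.
pose Z := [set p | L p /\ forall y, Y y -> evaluation y p = 0].
have limZ (U : set_system nat) : UltraFilter U -> \oo `<=` U ->
    exists2 p, Z p & h n @[n --> U] --> p.
  move=> UU ooU; have [p hp] := dual_ball_ultra_cvg h UU.
  exists p => //; split.
    by apply: (closed_cvg L _ _ _ hp); [exact: closed_closure|exact: nearW].
  move=> y Yy.
  apply: (cvg_unique (@norm_hausdorff R R^o) (evaluation_cvg (x := y) hp)).
  exact: cvg_trans (cvg_app _ ooU) (hY y Yy).
(* For [k = 0] no closeness is required, so [E 0 n p] just says that [p] is in [Z]. *)
pose E k n p := Z p /\ forall j, (j < k)%N ->
  `|evaluation (d j) (h n) - evaluation (d j) p| < k.+1%:R^-1.
have [z [Zz zE]] : exists z : nat -> dual_ball X, (forall n, E 0 n (z n)) /\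
    forall k, \forall n \near \oo, E k n (z n).
  apply: diagonal_choice.
  - move=> k n p [Zp pE]; split=> // j jk.
    apply: lt_le_trans (pE _ (ltnW jk)) _.
    by rewrite lef_pV2 ?posrE// ler_nat.
  - move=> n; have [U [UU ooU]] := ultraFilterLemma eventually_filter.
    by have [p Zp _] := limZ U UU ooU; exists p.
  (* Otherwise a free ultrafilter contains the set of bad [n]; the limit of [h] along it lies in [Z]
     and solves [E k n] for some bad [n]. *)
  - move=> k; apply: contrapT => /not_near_ultra[U [UU ooU UE]].
    have [p Zp hp] := limZ U UU ooU.
    have kpos : 0 < k.+1%:R^-1 :> R by rewrite invr_gt0.
    have [n [nE Ep]] : exists n, (~ exists z, E k n z) /\ E k n p.
    2: by apply: nE; exists p.
    apply: (@filter_ex _ U); near=> n; split; first by near: n.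
    split=> //; near: n.
    suff : \forall n \near U, forall j : 'I_k,
        `|evaluation (d j) (h n) - evaluation (d j) p| < k.+1%:R^-1.
      by apply: filterS => m + j jk; move=> /(_ (Ordinal jk)).
    apply: filter_forall => j.
    have /cvgrPdist_lt hd :
        evaluation (d j) (h n) @[n --> U] --> evaluation (d j) p.
      exact: evaluation_cvg.
    by apply: filterS (hd _ kpos) => m; rewrite distrC.
exists z; split=> [n y Yy|x]; first by have [[_ ->]] := Zz n.
apply: ultra_cvg => U UU ooU.
have [p [Lp _] hp] := limZ U UU ooU.
have [q zq] := dual_ball_ultra_cvg z UU.
have Lq : L q.
  apply: (closed_cvg L _ _ _ zq); first exact: closed_closure.
  by apply: nearW => n; have [[]] := Zz n.
have hx v : evaluation v (h n) @[n --> U] --> evaluation v p.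
  exact: evaluation_cvg.
have zx v : evaluation v (z n) @[n --> U] --> evaluation v q.
  exact: evaluation_cvg.
(* Both limits lie in [L], so agreement at every [d k] gives agreement at [x]. *)
suff pq : evaluation x p = evaluation x q.
  by rewrite -(subrr (evaluation x p)) {2}pq; exact: cvgB (hx x) (zx x).
apply: dsep => // k; apply/eqP; rewrite -subr_eq0; apply/eqP.
apply: (cvg_unique (@norm_hausdorff R R^o)) (cvgB (hx (d k)) (zx (d k))) _.
apply: cvg_trans (cvg_app _ ooU) _.
apply/cvgr0Pnorm_lt => eps eps0.
(* Level [l] controls [d k] because [k < l], with error [l.+1%:R^-1] below [eps]. *)
near \oo => l.
have kl : (k < l)%N by near: l; exact: nbhs_infty_gt.
have leps : l.+1%:R^-1 < eps.
  by near: l; exact: near_infty_natSinv_lt (PosNum eps0).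
apply: filterS (zE l) => n [_ /(_ k kl) zn]; exact: lt_trans zn leps.
Unshelve. all: by end_near. Qed.

(** * Extension of operators into the space of null sequences *)

Theorem theorem2p5 (R : realType) (X : completeNormedModType R) :
  monolithic (dual_ball X) -> c0_extension_property 2 X.
Proof.
move=> mono Y _ T Tb; pose t := opnorm T.
have t0 : 0 <= t by exact: opnorm_ge0.
(* [0^-1 = 0] is harmless here, as [t = 0] forces [T = 0]. *)
have tT y n : t * (t^-1 * val (T y) n) = val (T y) n.
  have [tz|tnz] := eqVneq t 0; last by rewrite mulVKf.
  have Ty0 : T y = 0.
    apply/normr0_eq0/eqP; rewrite eq_le normr_ge0 andbT.
    by apply: (le_trans (le_opnorm y Tb)); rewrite -/t tz mul0r.
  by rewrite tz mul0r Ty0.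
have /choice[h hT] n : exists p : dual_ball X,
    forall y : subsp Y, evaluation (val y) p = t^-1 * val (T y) n.
  have [|f fE] := @linear_funP R (subsp Y) R^o (fun y => t^-1 * val (T y) n).
    move=> a u v; rewrite linearP.
    have -> : val (a *: T u + T v) n = a * val (T u) n + val (T v) n by [].
    by rewrite mulrDr mulrCA.
  have [y|g gf g1] := hahn_banach (f := f).
    rewrite fE normrM normfV (ger0_norm t0).
    have := le_trans (c0_le_norm (T y) n) (le_opnorm y Tb).
    rewrite -/t; have [->|tnz] := eqVneq t 0; first by rewrite invr0 !mul0r.
    by rewrite ler_pdivrMl// lt_neqAle eq_sym tnz.
  have [p pg] := dual_exists g1.
  by exists p => y; rewrite /evaluation pg gf fE.
have [|z [zY hz]] := @weak_star_null_approximation R X [set x | x \in Y] h mono.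
  (* On [Y] the values of [h n] are the coordinates of [T y] scaled by [t^-1], and these tend to
     0. *)
  move=> y Yy.
  rewrite -[X in X @ _]/(evaluation y \o h).
  have -> : evaluation y \o h = fun n => t^-1 *: (val (T (Sub y Yy)) n : R^o).
    by apply/funext => n; exact: (hT n (Sub y Yy)).
  rewrite -[X in _ --> X](scaler0 _ t^-1).
  by apply: cvgZl_tmp; exact/asboolP/(valP (T _)).
have w0 x : (fun n => t * (evaluation x (h n) - evaluation x (z n)) : R^o)
    \in @null_sequence R.
  apply/asboolP; rewrite -[X in _ --> X](scaler0 _ t).
  by apply: (@cvgZl_tmp _ R^o); exact: hz.
pose w x : c0 R := exist (fun u => u \in @null_sequence R) _ (w0 x).
have [a x y|Tt TtE] := @linear_funP R X (c0 R) w.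
  apply/val_inj/funext => n /=.
  have lin p : evaluation (a *: x + y) p = a * evaluation x p + evaluation y p.
    by rewrite /evaluation linearP.
  transitivity (a * (t * (evaluation x (h n) - evaluation x (z n)))
      + t * (evaluation y (h n) - evaluation y (z n))); last by [].
  by rewrite !lin; ring.
(* The factor 2 arises because [h n] and [z n] both lie in the dual ball. *)
have Tt2 x : `|Tt x| <= 2 * t * `|x|.
  rewrite TtE; apply: c0_norm_le => n /=.
  rewrite normrM (ger0_norm t0) mulrAC [leRHS]mulrC ler_wpM2l//.
  apply: le_trans (ler_normB _ _) _.
  by rewrite mulr_natl mulr2n lerD// evaluation_le.
exists Tt; split.
- by exists (2 * t).
- move=> y; apply/val_inj/funext => n; rewrite TtE /= zY ?subr0 ?hT ?tT//.
  exact: valP.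
- by apply: opnorm_le => //; rewrite mulr_ge0.
Qed.
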